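(* Let $P=(P_{ij})_{i,j\in E}$ be an irreducible aperiodic transition matrix on a countable state space $E$ and let $H$ be a non-empty finite subset of $E$. Suppose the chain is $\ell$-ergodic for some non-negative integer $\ell$. Then the chain is not $(\ell+1)$-ergodic if and only if there is a sequence $\{y^{(n)}\}_{n=1}^{\infty}$ of real-valued functions $y^{(n)}=(y^{(n)}_i)_{i\in E}$ on $E$ satisfying the following conditions: (1) for each $n\ge 1$, $\sup_{i\in E} y^{(n)}_i<\infty$ and $y=y^{(n)}$ solves the inequality $$y_i\le \sum_{j\notin H}P_{ij}\,y_j+\mathbf{E}_i\sigma_H^{\ell},\qquad i\in E;$$ (2) $\sup_{n\ge 1}\max_{i\in H} y^{(n)}_i=\infty$ (or equivalently, $\varlimsup_{n\to\infty}\max_{i\in H}y^{(n)}_i=\infty$).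
   Context: $P$ is a stochastic matrix and $(X_n)_{n\ge0}$ the associated discrete-time Markov chain; $\sigma_H=\inf\{n\ge1: X_n\in H\}$ for $H\subseteq E$. For an integer $\ell\ge1$ the chain is $\ell$-ergodic iff $\max_{i\in H}\mathbf{E}_i\sigma_H^{\ell}<\infty$ for some (equivalently, any) non-empty finite $H\subseteq E$. The chain is called $0$-ergodic when it is recurrent; $1$-ergodic means ergodic. The functions $y^{(n)}$ are finite-valued but need not be non-negative nor bounded below. *)

(* Defs.v *)
(* MathComp-Analysis *)
From HB Require Import structures.
From mathcomp Require Import all_boot all_order all_algebra finmap.
From mathcomp Require Import all_classical all_reals all_analysis.

Set Implicit Arguments.
Unset Strict Implicit.
Unset Printing Implicit Defensive.

Import Order.TTheory GRing.Theory Num.Theory.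

Local Open Scope classical_set_scope.
Local Open Scope ring_scope.
Local Open Scope ereal_scope.

Section TransitionMatrix.
Context {R : realType} {E : countType}.
Implicit Types P : E -> E -> R.

Definition stochastic P : Prop :=
  (forall i j, (0 <= P i j)%R) /\
  (forall i, \esum_(j in setT) (P i j)%:E = 1).

Fixpoint nstep P (n : nat) (i j : E) : \bar R :=
  if n is m.+1 then \esum_(k in setT) ((P i k)%:E * nstep P m k j)
  else if i == j then 1 else 0.

Definition irreducible P : Prop :=
  forall i j, exists n : nat, 0 < nstep P n i j.

(* For every state i, gcd {n >= 1 : (P^n)_ii > 0} = 1. The gcd of a possibly
   infinite set of integers is expressed through its common divisors; d = 0
   divides only 0, so the empty set does not qualify. *)
Definition aperiodic P : Prop :=
  forall (i : E) (d : nat),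
    (forall n : nat, (0 < n)%N -> 0 < nstep P n i i -> (d %| n)%N) -> d = 1%N.

(* The sum of a signed family over the unordered index set D, as the difference
   of the sums of the positive and negative parts ([esum] itself is a supremum
   over finite subsets, meaningful for non-negative families only). When the
   positive part is summable, this is the usual value in [-oo, +oo[. *)
Definition signed_esum (D : set E) (f : E -> \bar R) : \bar R :=
  \esum_(j in D) f^\+ j - \esum_(j in D) f^\- j.

End TransitionMatrix.

Section Chain.
Context {d : measure_display} {Omega : measurableType d} {R : realType}
  {E : countType}.
Implicit Types (P : E -> E -> R) (Pr : E -> probability Omega R)
  (X : nat -> Omega -> E) (H : {fset E}).

(* (X_n) is, under each Pr i, a Markov chain with transition matrix P started at
   i. The Markov property is written multiplied out, so that it also makes sense
   for trajectories of probability 0; the measurability condition is that of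
   random variables valued in the countable set E with all its subsets. *)
Definition markov_chain P Pr X : Prop :=
  [/\ forall n j, measurable [set w | X n w = j],
      forall i, Pr i [set w | X 0%N w = i] = 1 &
      forall i n (s : nat -> E),
        Pr i [set w | forall k, (k <= n.+1)%N -> X k w = s k] =
        Pr i [set w | forall k, (k <= n)%N -> X k w = s k] *
        (P (s n) (s n.+1))%:E].

(* sigma_H = inf {n >= 1 : X_n in H}, equal to +oo when H is never hit. *)
Definition hitting_time X H (w : Omega) : \bar R :=
  ereal_inf [set n%:R%:E | n in [set n : nat | (0 < n)%N /\ X n w \in H]].

(* E_i sigma_H^l, with the convention (+oo)^0 = 1. *)
Definition hitting_moment Pr X H (l : nat) (i : E) : \bar R :=
  \int[Pr i]_w (hitting_time X H w) ^+ l.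

Definition recurrent Pr X : Prop :=
  forall i, Pr i [set w | exists2 n : nat, (0 < n)%N & X n w = i] = 1.

Definition l_ergodic Pr X (l : nat) : Prop :=
  if l is 0%N then recurrent Pr X
  else exists2 H : {fset E}, H != fset0 &
         \big[maxe/-oo]_(i <- H) hitting_moment Pr X H l i < +oo.

Definition drift_inequality P Pr X H (l : nat) (y : E -> R) : Prop :=
  forall i, (y i)%:E <=
    signed_esum [set j | j \notin H] (fun j => (P i j * y j)%:E)
      + hitting_moment Pr X H l i.

End Chain.

(* Main.v *)
Require Import Defs.
From mathcomp Require Import all_boot all_order all_algebra finmap.
From mathcomp Require Import all_classical all_reals all_analysis.
From mathcomp Require Import measurable_realfun lra zify.

(* Write a^k_i for the probability P_i(sigma_H > k) and S_i for the sum of the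
   (k+1)^l a^k_i. Summation by layers gives E_i sigma_H^l as the sum of the
   ((k+1)^l - k^l) a^k_i, so S is finite at i iff E_i sigma_H^(l+1) is, and
   S = E sigma_H^l + Q S, where Q is the transition operator restricted to the
   complement of H. If the chain is not (l+1)-ergodic, the partial sums of S are
   bounded solutions of the inequality that blow up at some point of H.
   Conversely, iterating the inequality gives y <= S + (sup y) a^k for all k,
   hence y <= S wherever S is finite. It remains to see that the finiteness of S
   on H does not depend on the finite set H. *)

Set Implicit Arguments.
Unset Strict Implicit.
Unset Printing Implicit Defensive.

Import Order.TTheory GRing.Theory Num.Theory.

Local Open Scope classical_set_scope.
Local Open Scope ring_scope.
Local Open Scope ereal_scope.

(** * Non-negative sums over a countable index set *)

Section CountableSums.
Context {R : realType} {E : countType}.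
Implicit Types (A : set E) (f g : E -> \bar R).

(** States are enumerated by their codes, and a code of no state contributes 0. This makes results
    on series of non-negative terms available for [esum]. *)
Lemma esum_countE A f : (forall i, A i -> 0 <= f i) ->
  \esum_(i in A) f i =
  \sum_(n <oo) oapp (fun i => if i \in A then f i else 0) 0 (pickle_inv n).
Proof.
move=> f0; rewrite esum_mkcond.
set g := (fun i : E => if i \in A then f i else 0).
have g0 i : 0 <= g i by rewrite /g; case: ifPn => // /set_mem /f0.
have h0 n : 0 <= oapp g 0 (pickle_inv n) by case: pickle_inv => //=.
rewrite nneseries_esumT//.
have -> : \esum_(n in [set: nat]) oapp g 0 (pickle_inv n) =
    \esum_(n in choice.pickle @` [set: E]) oapp g 0 (pickle_inv n).
  rewrite [RHS]esum_mkcond; apply: eq_esum => n _.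
  case: ifPn => //; rewrite notin_setE => nE.
  case e : (pickle_inv n) => [x|//]; exfalso; apply: nE; exists x => //.
  by have := @pickle_invK E n; rewrite e.
rewrite esum_image; last by move=> x y _ _; exact: (pcan_inj (@choice.pickleK E)).
by apply: eq_esum => i _; rewrite pickleK_inv.
Qed.

Lemma ge0_esumZl A f (r : R) : (forall i, A i -> 0 <= f i) -> (0 <= r)%R ->
  \esum_(i in A) (r%:E * f i) = r%:E * \esum_(i in A) f i.
Proof.
move=> f0 r0; rewrite !esum_countE//; last first.
  by move=> i /f0; apply: mule_ge0; rewrite lee_fin.
rewrite -nneseriesZl; last first.
  by move=> n _; case: pickle_inv => //= i; case: ifPn => // /set_mem /f0.
apply: eq_eseriesr => n _; case: pickle_inv => //= [i|]; last by rewrite mule0.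
by case: ifPn; rewrite ?mule0.
Qed.

Lemma esum_nneseries A (f : nat -> E -> \bar R) : (forall n i, 0 <= f n i) ->
  \esum_(i in A) \sum_(n <oo) f n i = \sum_(n <oo) \esum_(i in A) f n i.
Proof.
move=> f0; rewrite esum_countE; last by move=> i _; exact: nneseries_ge0.
transitivity (\sum_(m <oo) \sum_(n <oo)
    oapp (fun i => if i \in A then f n i else 0) 0 (@pickle_inv E m)).
  apply: eq_eseriesr => m _; case: pickle_inv => //= [i|]; last first.
    by rewrite eseries0.
  by case: ifPn => // _; rewrite eseries0.
rewrite nneseries_interchange; last first.
  by move=> m n; case: pickle_inv => //= i; case: ifP.
by apply: eq_eseriesr => n _; rewrite esum_countE.
Qed.

(** The level sets of [X] are indexed by codes, which makes them a disjoint sequence; measurability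
    of [B] itself follows from that of its pieces. *)
Lemma measure_countable_partition d (T : measurableType d)
    (mu : {measure set T -> \bar R}) (X : T -> E) (B : set T) :
  (forall j, measurable (B `&` [set w | X w = j])) ->
  mu B = \esum_(j in setT) mu (B `&` [set w | X w = j]).
Proof.
move=> mX; pose F n := if @pickle_inv E n is Some j then
  B `&` [set w | X w = j] else set0.
have FE : B = \bigcup_n F n.
  apply/seteqP; split=> [w Bw|w [n _]]; last by rewrite /F; case: pickle_inv => // j [].
  by exists (choice.pickle (X w)) => //; rewrite /F pickleK_inv.
have mF n : measurable (F n) by rewrite /F; case: pickle_inv.
rewrite {1}FE measure_semi_bigcup//.
- rewrite esum_countE//; apply: eq_eseriesr => n _; rewrite /F.
  by case: pickle_inv => //= j; rewrite in_setT.
- move=> m n _ _ [w []]; rewrite /F.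
  have := @pickle_invK E m; have := @pickle_invK E n.
  case: pickle_inv => // j /= <-; case: pickle_inv => // k /= <-.
  by case=> _ /= <- [] _ /= <-.
- exact: bigcupT_measurable.
Qed.

End CountableSums.

(** * The restricted transition operator and the avoidance probabilities *)

Section Operator.
Context {R : realType} {E : countType}.
Variable P : E -> E -> R.
Hypothesis hP : stochastic P.
Implicit Types (A : set E) (f g : E -> \bar R).

(** For [A] the complement of H this is the operator Q; for [A = setT] it is P itself. *)
Definition kernel_on A f i := \esum_(j in A) ((P i j)%:E * f j).

Let P0 i j : 0 <= (P i j)%:E. Proof. by rewrite lee_fin; case: hP. Qed.

Lemma kernel_on_ge0 A f i : (forall j, 0 <= f j) -> 0 <= kernel_on A f i.
Proof. by move=> f0; apply: esum_ge0 => j _; rewrite mule_ge0. Qed.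

Lemma le_kernel_on A f g i : (forall j, A j -> f j <= g j) ->
  kernel_on A f i <= kernel_on A g i.
Proof. by move=> fg; apply: le_esum => j Aj; rewrite lee_wpmul2l// fg. Qed.

Lemma kernel_onD A f g i : (forall j, 0 <= f j) -> (forall j, 0 <= g j) ->
  kernel_on A (fun j => f j + g j) i = kernel_on A f i + kernel_on A g i.
Proof.
move=> f0 g0; rewrite -esumD; [|by move=> j _; rewrite mule_ge0..].
by apply: eq_esum => j _; rewrite ge0_muleDr.
Qed.

Lemma kernel_onZ A f i (r : R) : (forall j, 0 <= f j) -> (0 <= r)%R ->
  kernel_on A (fun j => r%:E * f j) i = r%:E * kernel_on A f i.
Proof.
move=> f0 r0; rewrite -ge0_esumZl//; last by move=> j _; rewrite mule_ge0.
by apply: eq_esum => j _; rewrite muleCA.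
Qed.

Lemma kernel_on_sum A (f : nat -> E -> \bar R) n i : (forall k j, 0 <= f k j) ->
  kernel_on A (fun j => \sum_(k < n) f k j) i = \sum_(k < n) kernel_on A (f k) i.
Proof.
move=> f0; rewrite -esum_sum; last by move=> j k _ _; rewrite mule_ge0.
by apply: eq_esum => j _; rewrite ge0_sume_distrr.
Qed.

Lemma kernel_on_nneseries A (f : nat -> E -> \bar R) i :
  (forall k j, 0 <= f k j) ->
  kernel_on A (fun j => \sum_(k <oo) f k j) i = \sum_(k <oo) kernel_on A (f k) i.
Proof.
move=> f0; rewrite -esum_nneseries; last by move=> k j; rewrite mule_ge0.
by apply: eq_esum => j _; rewrite nneseriesZl.
Qed.

Lemma kernel_onT_cst i (r : R) : (0 <= r)%R -> kernel_on setT (cst r%:E) i = r%:E.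
Proof.
move=> r0; rewrite /kernel_on.
have -> : \esum_(j in [set: E]) ((P i j)%:E * cst r%:E j) =
   \esum_(j in [set: E]) (r%:E * (P i j)%:E) by apply: eq_esum => j _; rewrite muleC.
by rewrite ge0_esumZl// (proj2 hP) mule1.
Qed.

Lemma kernel_onT_split A f i : (forall j, 0 <= f j) ->
  kernel_on setT f i = kernel_on A f i + kernel_on (~` A) f i.
Proof.
move=> f0; rewrite /kernel_on (esumID A); last by move=> j _; rewrite mule_ge0.
by rewrite !setTI.
Qed.

Lemma kernel_on_cst_le A i (r : R) : (0 <= r)%R -> kernel_on A (cst r%:E) i <= r%:E.
Proof.
move=> r0; rewrite -[leRHS](kernel_onT_cst i r0) (kernel_onT_split A)//.
by rewrite leeDl// kernel_on_ge0.
Qed.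

Lemma kernel_on_le_setT A f i : (forall j, 0 <= f j) ->
  kernel_on A f i <= kernel_on setT f i.
Proof. by move=> f0; rewrite (kernel_onT_split A)// leeDl// kernel_on_ge0. Qed.

(* The probability, starting at i, that X_1, ..., X_n all lie in A. *)
Fixpoint avoid A n i : \bar R := if n is m.+1 then kernel_on A (avoid A m) i else 1.

Lemma avoid_ge0 A n i : 0 <= avoid A n i.
Proof. by elim: n i => [|n IH] i //=; exact: kernel_on_ge0. Qed.

Lemma avoidS_le A n i : avoid A n.+1 i <= avoid A n i.
Proof.
elim: n i => [|n IH] i /=; first exact: kernel_on_cst_le.
by apply: le_kernel_on => j _; exact: IH.
Qed.

Lemma avoid_nincr A m n i : (m <= n)%N -> avoid A n i <= avoid A m i.
Proof.
move=> /subnK <-; elim: (n - m)%N => [|k IH] //.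
by apply: le_trans IH; rewrite addSn avoidS_le.
Qed.

Lemma avoid_le1 A n i : avoid A n i <= 1.
Proof. exact: (@avoid_nincr A 0 n). Qed.

Lemma avoid_fin A n i : avoid A n i \is a fin_num.
Proof.
by rewrite ge0_fin_numE ?avoid_ge0// (le_lt_trans (avoid_le1 _ _ _))// ltry.
Qed.

End Operator.

Arguments avoid {R E} P A n i : simpl never.

(** * Series, and the integer weights of the summation by layers *)

Lemma nneseries_recS (R : realType) (f : nat -> \bar R) : (forall k, 0 <= f k) ->
  \sum_(k <oo) f k = f 0%N + \sum_(k <oo) f k.+1.
Proof.
move=> f0; rewrite nneseries_recl//; congr (_ + _).
by rewrite -nneseries_addn//; apply: eq_eseriesr => k _; rewrite addn1.
Qed.

Lemma nneseries_le (R : realType) (f : nat -> \bar R) (x : \bar R) :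
  (forall k, 0 <= f k) -> (forall n, \sum_(k < n) f k <= x) ->
  \sum_(k <oo) f k <= x.
Proof.
move=> f0 fx; apply: lime_le; first exact: is_cvg_nneseries.
by apply: nearW => n; rewrite big_mkord.
Qed.

(* n ^ l is the sum of the weights of the k < n, for n >= 1; the weight of 0 is
   1 also for l = 0, in accordance with sigma ^ 0 = 1. *)
Definition layer_weight (l k : nat) : nat :=
  if k is 0%N then 1%N else (k.+1 ^ l - k ^ l)%N.

Lemma expn_leS l k : (k ^ l <= k.+1 ^ l)%N.
Proof. by case: l => // l; rewrite leq_exp2r. Qed.

Lemma layer_weightS l k : (layer_weight l k.+1 + k.+1 ^ l = k.+2 ^ l)%N.
Proof. by rewrite /= subnK// expn_leS. Qed.

Lemma layer_weight_sum l n : (\sum_(k < n.+1) layer_weight l k = n.+1 ^ l)%N.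
Proof.
elim: n => [|n IH]; first by rewrite big_ord_recl big_ord0 exp1n.
by rewrite big_ord_recr IH; exact: etrans (addnC _ _) (layer_weightS _ _).
Qed.

(** Split [k.+2 ^ l.+1] into one copy of [k.+2 ^ l] and [k.+1] further copies, each at least
    [k.+1 ^ l]. With [layer_weight_le] this makes the moment of order [l.+1] and the power sum of
    order [l] comparable. *)
Lemma layer_weight_ge l k : (k.+1 ^ l <= layer_weight l.+1 k)%N.
Proof.
case: k => [|k]; first by rewrite exp1n.
rewrite -(leq_add2r (k.+1 ^ l.+1)) layer_weightS !expnS (mulSn k.+1) leq_add2l.
by rewrite leq_mul// expn_leS.
Qed.

(** A discrete mean value inequality, by induction on the exponent: the induction hypothesis is
    multiplied by [k.+2]. *)
Lemma layer_weight_le l k : (layer_weight l.+1 k <= l.+1 * k.+1 ^ l)%N.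
Proof.
case: k => [|k]; first by rewrite exp1n muln1.
elim: l => [|l IH]; first by rewrite /= !expn1 expn0 subSnn.
rewrite -(leq_add2r (k.+1 ^ l.+2)) layer_weightS.
move: IH; rewrite -(leq_add2r (k.+1 ^ l.+1)) layer_weightS.
rewrite !(expnS _ l.+1) => /(leq_mul (leqnn k.+2)) /leq_trans; apply.
(* What remains reduces to [k.+1 * b <= k.+2 * a], which follows from [b <= a]. *)
rewrite expnS; move: (expn_leS l k.+1).
set a := (k.+2 ^ l)%N; set b := (k.+1 ^ l)%N; rewrite expnS -/b => ab; nia.
Qed.

(** * Moments and power sums built from the avoidance probabilities *)

Section Moments.
Context {R : realType} {E : countType}.
Variable P : E -> E -> R.
Hypothesis hP : stochastic P.
Implicit Types (A : set E) (w : nat -> nat).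

Definition avoid_sum w A i : \bar R := \sum_(k <oo) (w k)%:R%:E * avoid P A k i.
(** For [A] the complement of H, [time_moment] is the moment of sigma_H (see [hitting_momentE]),
    [power_sum] is S, and [power_psum] gives the partial sums of S that serve as the functions
    y^(n). *)
Definition time_moment l := avoid_sum (layer_weight l).
Definition power_sum l := avoid_sum (fun k => k.+1 ^ l)%N.
Definition power_psum l n A i : \bar R :=
  \sum_(k < n) (k.+1 ^ l)%N%:R%:E * avoid P A k i.

Let term_ge0 w A k i : 0 <= (w k)%:R%:E * avoid P A k i.
Proof. by rewrite mule_ge0 ?avoid_ge0// lee_fin. Qed.

Let power_term_ge0 l A k i : 0 <= (k.+1 ^ l)%:R%:E * avoid P A k i.
Proof. exact: (term_ge0 (fun k => k.+1 ^ l)%N). Qed.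

Lemma avoid_sum_ge0 w A i : 0 <= avoid_sum w A i.
Proof. exact: nneseries_ge0. Qed.

Lemma le_avoid_sum w w' A i : (forall k, (w k <= w' k)%N) ->
  avoid_sum w A i <= avoid_sum w' A i.
Proof.
move=> ww'; apply: lee_nneseries => // k _.
by rewrite lee_wpmul2r ?avoid_ge0// lee_fin ler_nat.
Qed.

Lemma power_sum_le_moment l A i : power_sum l A i <= time_moment l.+1 A i.
Proof. by apply: le_avoid_sum => k; exact: layer_weight_ge. Qed.

Lemma moment_le_power_sum l A i :
  time_moment l.+1 A i <= l.+1%:R%:E * power_sum l A i.
Proof.
rewrite /power_sum /time_moment /avoid_sum -nneseriesZl//.
apply: lee_nneseries => [k _ _|k _]; first exact: (term_ge0 (layer_weight l.+1)).
rewrite muleA -EFinM -natrM lee_wpmul2r ?avoid_ge0// lee_fin ler_nat.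
exact: layer_weight_le.
Qed.

Lemma time_moment0 A i : time_moment 0 A i = 1.
Proof.
rewrite /time_moment /avoid_sum nneseries_recS// eseries0 ?adde0 ?mule1// => k _ _.
by rewrite /= subnn mul0e.
Qed.

Lemma power_sum_ge1 l A i : 1 <= power_sum l A i.
Proof.
rewrite /power_sum /avoid_sum nneseries_recS//= exp1n mule1 leeDl//.
by apply: nneseries_ge0 => k _ _; exact: (term_ge0 (fun k => k.+1 ^ l)%N A k.+1).
Qed.

Lemma power_sum_mono l A i : power_sum l A i <= power_sum l.+1 A i.
Proof. by apply: le_avoid_sum => k; rewrite leq_pexp2l. Qed.

(** Applying Q shifts [avoid] by one index, and [layer_weight_sum] in its incremental form
    [layer_weightS] turns the weight [k.+1 ^ l] of the shifted term into [k.+2 ^ l]. *)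
Lemma power_sumE l A i :
  time_moment l A i + kernel_on P A (power_sum l A) i = power_sum l A i.
Proof.
rewrite kernel_on_nneseries//.
have -> : \sum_(k <oo) kernel_on P A (fun j => (k.+1 ^ l)%:R%:E * avoid P A k j) i =
    \sum_(k <oo) (k.+1 ^ l)%:R%:E * avoid P A k.+1 i.
  by apply: eq_eseriesr => k _; rewrite kernel_onZ//; exact: avoid_ge0.
rewrite /time_moment /power_sum /avoid_sum nneseries_recS//.
rewrite [RHS]nneseries_recS//= exp1n mule1 -addeA; congr (_ + _).
rewrite -nneseriesD//; last by move=> k _ _; exact: (term_ge0 (fun k => k ^ l)%N A k.+1).
  apply: eq_eseriesr => k _.
  by rewrite -ge0_muleDl ?lee_fin// -EFinD -natrD layer_weightS.
by move=> k _ _; exact: (term_ge0 (layer_weight l) A k.+1).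
Qed.

Lemma power_psum_ge0 l n A i : 0 <= power_psum l n A i.
Proof. by apply: sume_ge0 => k _; exact: power_term_ge0. Qed.

Lemma power_psumS l n A i : power_psum l n A i <= power_psum l n.+1 A i.
Proof. by rewrite /power_psum big_ord_recr/= leeDl. Qed.

Lemma power_psum_le l n A i : power_psum l n A i <= power_sum l A i.
Proof.
rewrite /power_psum -(big_mkord xpredT (fun k => (k.+1 ^ l)%:R%:E * avoid P A k i)).
exact: nneseries_lim_ge.
Qed.

Lemma power_sum_le l A i x : (forall n, power_psum l n A i <= x) ->
  power_sum l A i <= x.
Proof. exact: nneseries_le. Qed.

Lemma power_psum_bound l n A i :
  power_psum l n A i <= (\sum_(k < n) (k.+1 ^ l)%:R)%:E.
Proof.
rewrite -sumEFin; apply: lee_sum => k _.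
by rewrite -[leRHS]mule1 lee_wpmul2l ?lee_fin// avoid_le1.
Qed.

Lemma power_psum_fin l n A i : power_psum l n A i \is a fin_num.
Proof.
rewrite ge0_fin_numE ?power_psum_ge0//.
by rewrite (le_lt_trans (power_psum_bound _ _ _ _))// ltry.
Qed.

(** The truncated form of [power_sumE]. It would be an equality with the moment series cut after
    [n.+1] terms; completing that series gives the inequality. *)
Lemma power_psum_drift l n A i :
  power_psum l n.+1 A i <= time_moment l A i + kernel_on P A (power_psum l n A) i.
Proof.
rewrite /power_psum (@kernel_on_sum _ _ P hP A (fun k j => (k.+1 ^ l)%:R%:E * avoid P A k j))//.
have -> : \sum_(k < n) kernel_on P A (fun j => (k.+1 ^ l)%:R%:E * avoid P A k j) i =
    \sum_(k < n) (k.+1 ^ l)%:R%:E * avoid P A k.+1 i.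
  by apply: eq_bigr => k _; rewrite kernel_onZ//; exact: avoid_ge0.
apply: (@le_trans _ _ (\sum_(k < n.+1) (layer_weight l k)%:R%:E * avoid P A k i +
    \sum_(k < n) (k.+1 ^ l)%:R%:E * avoid P A k.+1 i)).
  rewrite /power_psum !big_ord_recl/= exp1n mule1 -addeA leeD2l// -big_split/=.
  rewrite le_eqVlt; apply/orP; left; apply/eqP; apply: eq_bigr => k _.
  by rewrite -ge0_muleDl ?lee_fin// -EFinD -natrD layer_weightS.
rewrite leeD2r// -(big_mkord xpredT (fun k => (layer_weight l k)%:R%:E * avoid P A k i)).
exact: nneseries_lim_ge.
Qed.

(** Each of the first n terms of S is at least a^n, as a^k decreases in k and the weights are at
    least 1. Hence a^n tends to 0 wherever S is finite. *)
Lemma avoid_le_power_sum l n A i :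
  n%:R%:E * avoid P A n i <= power_sum l A i.
Proof.
apply: le_trans (power_psum_le l n A i).
rewrite /power_psum -[n in n%:R]card_ord -sum1_card natr_sum -sumEFin.
rewrite ge0_sume_distrl//; apply: lee_sum => k _.
rewrite lee_pmul ?lee_fin ?avoid_ge0 ?ler_nat ?expn_gt0//.
by apply: avoid_nincr => //; exact: ltnW.
Qed.

End Moments.

(** * Escape from a proper subset and the comparison principle *)

Lemma seq_argmax (R : realDomainType) (T : eqType) (s : seq T) (f : T -> R) :
  s != [::] -> exists2 x, x \in s & forall y, y \in s -> (f y <= f x)%R.
Proof.
elim: s => // x s IH _; have [->|/IH [z zs zmax]] := eqVneq s [::].
  by exists x; rewrite ?mem_head// => y; rewrite inE => /eqP ->.
have [fxz|fzx] := leP (f x) (f z).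
  by exists z; rewrite ?inE ?zs ?orbT// => y /[!inE] /orP[/eqP ->//|/zmax].
exists x; rewrite ?mem_head// => y /[!inE] /orP[/eqP ->//|/zmax].
by move=> /le_trans; apply; exact: ltW.
Qed.

Section Comparison.
Context {R : realType} {E : countType}.
Variable P : E -> E -> R.
Hypothesis hP : stochastic P.
Implicit Types (A : set E) (f : E -> \bar R).

Let P0 i j : 0 <= (P i j)%:E. Proof. by rewrite lee_fin; case: hP. Qed.

Lemma kernel_on_mkcond A f i :
  kernel_on P A f i = kernel_on P setT (fun j => if j \in A then f j else 0) i.
Proof.
rewrite /kernel_on esum_mkcond; apply: eq_esum => j _.
by case: ifP; rewrite ?mule0.
Qed.

Lemma nstep_ge0 n i j : 0 <= nstep P n i j.
Proof.
elim: n i => [|n IH] i /=; first by case: ifP.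
by apply: esum_ge0 => k _; rewrite mule_ge0.
Qed.

(** The event X_n = h is disjoint from the event that X_0, ..., X_n all lie in [A]; the conditional
    accounts for X_0. *)
Lemma nstep_avoid_le1 A h n i : ~ A h ->
  nstep P n i h + (if i \in A then avoid P A n i else 0) <= 1.
Proof.
move=> Ah; elim: n i => [|n IH] i /=.
  have [->|_] := eqVneq i h; first by rewrite memNset// adde0.
  by rewrite add0e; case: ifP.
apply: (@le_trans _ _ (kernel_on P setT (nstep P n ^~ h) i + avoid P A n.+1 i)).
  by rewrite leeD2l//; case: ifP => // _; exact: avoid_ge0.
rewrite [avoid _ _ _ _]kernel_on_mkcond -kernel_onD//; first last.
- by move=> j; case: ifP => // _; exact: avoid_ge0.
- by move=> j; exact: nstep_ge0.
rewrite -[leRHS](kernel_onT_cst hP i ler01).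
by apply: le_kernel_on => // j _; exact: IH.
Qed.

Lemma avoid_lt1 A h i : irreducible P -> ~ A h -> exists n, avoid P A n i < 1.
Proof.
move=> irr Ah.
(* A first step to some [j] makes the total number of steps positive: irreducibility alone may
   return 0 steps, and [avoid] ignores the initial state. *)
have [j Pij] : exists j, (0 < P i j)%R.
  apply: contrapT => /forallNP Pi0; have := proj2 hP i.
  rewrite esum1 => [[/eqP]|j _]; first by rewrite eq_sym oner_eq0.
  by apply/eqP; rewrite eq_le P0 andbT leNgt; apply/negP; rewrite lte_fin; exact: Pi0.
have [n njh] := irr j h; exists n.+1.
have : nstep P n.+1 i h + avoid P A n.+1 i <= 1.
  rewrite [avoid _ _ _ _]kernel_on_mkcond -[nstep _ _ _ _]/(kernel_on P setT (nstep P n ^~ h) i).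
  rewrite -kernel_onD//; first last.
  - by move=> k; case: ifP => // _; exact: avoid_ge0.
  - by move=> k; exact: nstep_ge0.
  rewrite -[leRHS](kernel_onT_cst hP i ler01).
  by apply: le_kernel_on => // k _; exact: nstep_avoid_le1.
apply: contraPT; rewrite -leNgt => a1; apply/negP; rewrite -ltNge.
have nih : 0 < nstep P n.+1 i h.
  apply: (@lt_le_trans _ _ ((P i j)%:E * nstep P n j h)); first by rewrite mule_gt0.
  rewrite /= (esumID [set j])//; last by move=> k _; rewrite mule_ge0 ?nstep_ge0.
  rewrite setTI esum_set1 ?mule_ge0 ?nstep_ge0// leeDl// esum_ge0// => k _.
  by rewrite mule_ge0 ?nstep_ge0.
apply: (lt_le_trans _ (leeD2l _ a1)).
by rewrite -[ltLHS]add0e lteD2rE.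
Qed.

(** As [avoid] decreases in time, the maximum of the finitely many times and of the bounds serves
    all points at once. *)
Lemma avoid_uniform A (s : seq E) : (forall i, exists n, avoid P A n i < 1) ->
  exists m (r : R), [/\ (0 <= r)%R, (r < 1)%R &
    forall i, i \in s -> avoid P A m i <= r%:E].
Proof.
move=> a1; elim: s => [|x s [m [r [r0 r1 mr]]]].
  by exists 0%N, 0%R; split.
have [n xn] := a1 x; exists (maxn m n), (Num.max r (fine (avoid P A n x))).
split; first by rewrite le_max r0.
  by rewrite gt_max r1 -lte_fin fineK// avoid_fin.
move=> i /[!inE] /orP[/eqP ->|/mr imr].
  rewrite EFin_max le_max fineK ?avoid_fin//.
  by rewrite (avoid_nincr hP A x (leq_maxr m n)) orbT.
by rewrite EFin_max le_max (le_trans (avoid_nincr hP A i (leq_maxl m n))).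
Qed.

(* A discrete maximum principle. With D the maximum of U_N over H, induction on
   n <= N gives U_n <= W + D; running m further steps from there gives
   U_N <= W + m M + D a_m, where M bounds W on H and a_m <= r < 1 on H. Taken at
   the maximum point this bounds D independently of N. *)
Lemma comparison (H : {fset E}) A (U : nat -> E -> \bar R) (W W0 : E -> \bar R) :
  H != fset0 ->
  (forall n i, 0 <= U n i) -> (forall n i, U n i \is a fin_num) ->
  (forall i, U 0%N i = 0) -> (forall n i, U n i <= U n.+1 i) ->
  (forall n i, U n.+1 i <= W0 i + kernel_on P A (U n) i) ->
  (forall i, 0 <= W0 i) -> (forall i, 0 <= W i) ->
  (forall i, W0 i + kernel_on P [set j | j \notin H] W i <= W i) ->
  (forall i, i \in H -> W i < +oo) ->
  (forall i, exists n, avoid P A n i < 1) ->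
  exists2 C : R, (0 <= C)%R & forall n i, U n i <= W i + C%:E.
Proof.
move=> H0 U0 Ufin Uz UU drift W00 W_ge0 Wdrift Wfin a1.
have [m [r [r0 r1 mr]]] := avoid_uniform (enum_fset H) a1.
have [M M0 WM] : exists2 M : R, (0 <= M)%R & forall i, i \in H -> W i <= M%:E.
  have [x xH xmax] := seq_argmax (fun i => fine (W i)) H0.
  exists (fine (W x)); first by rewrite fine_ge0.
  move=> i iH; rewrite -[leLHS]fineK ?lee_fin; first exact: xmax.
  by rewrite ge0_fin_numE// Wfin.
have Uhomo n n' i : (n <= n')%N -> U n i <= U n' i.
  move=> /subnK <-; elim: (n' - n)%N => // k IH.
  by apply: le_trans IH _; rewrite addSn.
(* The solution of D = (m + 1) M + r D. *)
pose C : R := ((m%:R + 1) * M / (1 - r))%R.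
have C0 : (0 <= C)%R.
  by apply: divr_ge0; [rewrite mulr_ge0// addr_ge0|rewrite subr_ge0 ltW].
exists C => // n i.
pose N := (n + m)%N.
have [x xH xmax] := seq_argmax (fun i => fine (U N i)) H0.
pose D := fine (U N x).
have D0 : (0 <= D)%R by rewrite fine_ge0.
have UD j : j \in H -> U N j <= D%:E.
  by move=> jH; rewrite -[leLHS]fineK ?lee_fin//; exact: xmax.
(* [W] cut off on [H], where the constants [D] and [M] take over as bounds. *)
pose W' j := if j \in [set j | j \notin H] then W j else 0.
have W'0 j : 0 <= W' j by rewrite /W'; case: ifP.
have step1 k : (k <= N)%N -> forall j, U k j <= W j + D%:E.
  elim: k => [|k IH] kN j; first by rewrite Uz adde_ge0.
  apply: (le_trans (drift k j)).
  apply: (@le_trans _ _ (W0 j + kernel_on P setT (fun j => W' j + D%:E) j)).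
    rewrite leeD2l//; apply: le_trans (kernel_on_le_setT hP _ _ (U0 k)) _.
    apply: le_kernel_on => // y _; rewrite /W'; case: ifPn => [_|].
      exact: (IH (ltnW kN)).
    rewrite notin_setE/= => /negP; rewrite negbK => yH.
    by rewrite add0e; apply: le_trans (UD _ yH); apply: Uhomo; exact: ltnW.
  rewrite (kernel_onD hP)// (kernel_onT_cst hP _ D0) addeA leeD2r//.
  by rewrite -kernel_on_mkcond.
(* The set [A] may meet [H], where the hypothesis on [W] gives no control of the operator; each step
   then costs at most [M]. *)
have stepM j : W0 j + kernel_on P A W j <= W j + M%:E.
  apply: (@le_trans _ _ (W0 j + kernel_on P setT (fun j => W' j + M%:E) j)).
    rewrite leeD2l//; apply: le_trans (kernel_on_le_setT hP _ _ W_ge0) _.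
    apply: le_kernel_on => // y _; rewrite /W'; case: ifPn => [_|].
      by rewrite leeDl.
    rewrite notin_setE/= => /negP; rewrite negbK => yH.
    by rewrite add0e WM.
  rewrite (kernel_onD hP)// (kernel_onT_cst hP _ M0) addeA leeD2r//.
  by rewrite -kernel_on_mkcond.
have step2 k q : (q + k <= N)%N -> forall j,
    U (q + k)%N j <= W j + (k%:R * M)%:E + D%:E * avoid P A k j.
  elim: k => [|k IH] qk j.
    by rewrite mul0r adde0 mule1 addn0; apply: step1; rewrite addn0 in qk.
  rewrite addnS; apply: (le_trans (drift _ j)).
  apply: (@le_trans _ _ (W0 j + kernel_on P A
      (fun j => W j + (k%:R * M)%:E + D%:E * avoid P A k j) j)).
    rewrite leeD2l//; apply: le_kernel_on => // y _.
    by apply: IH; rewrite addnS in qk; exact: ltnW.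
  have kM0 : (0 <= k%:R * M)%R by rewrite mulr_ge0.
  have DA0 y : 0 <= D%:E * avoid P A k y by rewrite mule_ge0 ?lee_fin ?avoid_ge0.
  rewrite (kernel_onD hP)//; last by move=> y; rewrite adde_ge0 ?lee_fin.
  rewrite (kernel_onD hP)// addeA leeD//; last first.
    by rewrite kernel_onZ//; exact: avoid_ge0.
  rewrite addeA -[k.+1]add1n natrD mulrDl mul1r EFinD addeA leeD//.
  exact: kernel_on_cst_le.
have Dx : D%:E <= M%:E + (m%:R * M)%:E + D%:E * r%:E.
  have DE : D%:E = U N x by rewrite fineK.
  rewrite {1}DE; apply: le_trans (step2 m n (leqnn _) x) _.
  apply: leeD; first by rewrite leeD2r// WM.
  by rewrite lee_wpmul2l ?lee_fin// mr.
have DC : (D <= C)%R.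
  move: Dx; rewrite -!EFinM -!EFinD lee_fin => Dx.
  rewrite /C ler_pdivlMr ?subr_gt0//; lra.
apply: le_trans (Uhomo n N i (leq_addr _ _)) _.
by apply: le_trans (step1 N (leqnn _) i) _; rewrite leeD2l.
Qed.

End Comparison.

(** * Independence of the finite set, and the bound on subsolutions *)

Section Solidarity.
Context {R : realType} {E : countType}.
Variable P : E -> E -> R.
Hypothesis hP : stochastic P.
Implicit Types (A : set E) (H : {fset E}).

Let P0 i j : 0 <= (P i j)%:E. Proof. by rewrite lee_fin; case: hP. Qed.

(** An infinite value propagates backwards along positive transitions, since a state where V is
    infinite lies outside [H] and so enters the restricted sum. Irreducibility carries it back to a
    point of [H], a contradiction. *)
Lemma superharmonic_finite H (V : E -> \bar R) : irreducible P -> H != fset0 ->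
  (forall i, 0 <= V i) ->
  (forall i, kernel_on P [set j | j \notin H] V i <= V i) ->
  (forall i, i \in H -> V i < +oo) -> forall i, V i < +oo.
Proof.
move=> irr H0 V0 VV Vfin h; rewrite ltNge leye_eq; apply/negP => /eqP Vh.
have Vpred i j : (0 < P i j)%R -> V j = +oo -> V i = +oo.
  move=> Pij Vj; apply/eqP; rewrite -leye_eq; apply: le_trans (VV i).
  have [jH|jH] := boolP (j \in H); first by have := Vfin j jH; rewrite Vj ltxx.
  rewrite /kernel_on (esumID [set j]); last by move=> k _; rewrite mule_ge0.
  rewrite setIidr; last by move=> _ ->.
  rewrite esum_set1 ?mule_ge0// Vj gt0_muley// leeDl//.
  by apply: esum_ge0 => k _; rewrite mule_ge0.
have [i iH] : exists i, i \in H by apply/fset0Pn.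
suff Voo : V i = +oo by have := Vfin i iH; rewrite Voo ltxx.
have [n] := irr i h; move: (i); elim: n => [|n IH] {iH}j /=.
  by case: eqP => [->//|_]; rewrite ltxx.
move=> nj; have [k Pnk] : exists k, 0 < (P j k)%:E * nstep P n k h.
  apply: contrapT => /forallNP Pn0; move: nj; rewrite esum1 ?ltxx// => k _.
  by apply/eqP; rewrite eq_le mule_ge0 ?nstep_ge0// andbT leNgt; apply/negP.
have Pjk : (0 < P j k)%R.
  rewrite lt_neqAle -lee_fin P0 andbT; apply: contraTneq Pnk => <-.
  by rewrite mul0e ltxx.
by apply: (Vpred j k Pjk); apply: IH; move: Pnk; rewrite pmule_rgt0.
Qed.

Lemma power_sum_finite H l : irreducible P -> H != fset0 ->
  (forall i, i \in H -> power_sum P l [set j | j \notin H] i < +oo) ->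
  forall i, power_sum P l [set j | j \notin H] i < +oo.
Proof.
move=> irr H0; apply: superharmonic_finite => // i; first exact: avoid_sum_ge0.
by rewrite -[leRHS]power_sumE// leeDr// avoid_sum_ge0.
Qed.

(* Once the moments for H are controlled by those for H', the multiple of the
   power sum for H' is a supersolution to compare with. *)
Lemma power_sum_step H H' l : irreducible P -> H != fset0 -> H' != fset0 ->
  (forall i, i \in H' -> power_sum P l [set j | j \notin H'] i < +oo) ->
  (exists2 C : R, (0 <= C)%R & forall i, time_moment P l [set j | j \notin H] i <=
    C%:E * time_moment P l [set j | j \notin H'] i) ->
  exists2 C : R, (0 <= C)%R & forall i, power_sum P l [set j | j \notin H] i <=
    C%:E * power_sum P l [set j | j \notin H'] i.
Proof.
set A := [set j | j \notin H]; set A' := [set j | j \notin H'].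
move=> irr H0 H'0 Sfin [C C0 FC].
have [h hH] : exists h, h \in H by apply/fset0Pn.
have S0 i : 0 <= power_sum P l A' i by exact: avoid_sum_ge0.
have F0 i : 0 <= time_moment P l A' i by exact: avoid_sum_ge0.
have [||||||||||D D0 UD] := @comparison _ _ P hP H' A (power_psum P l ^~ A)
  (fun i => C%:E * power_sum P l A' i) (fun i => C%:E * time_moment P l A' i) H'0.
- by move=> n i; exact: power_psum_ge0.
- by move=> n i; exact: power_psum_fin.
- by move=> i; rewrite /power_psum big_ord0.
- by move=> n i; exact: power_psumS.
- move=> n i; apply: le_trans (power_psum_drift hP l n A i) _.
  by rewrite leeD2r.
- by move=> i; rewrite mule_ge0.
- by move=> i; rewrite mule_ge0.
- by move=> i; rewrite (kernel_onZ hP)// -ge0_muleDr ?kernel_on_ge0// power_sumE.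
- move=> i iH'; rewrite -ge0_fin_numE ?mule_ge0// fin_numM//.
  by rewrite ge0_fin_numE// Sfin.
- by move=> i; apply: (avoid_lt1 hP (h := h)) => //; rewrite /A/= hH.
exists (C + D)%R => [|i]; first by rewrite addr_ge0.
apply: power_sum_le => // n; apply: le_trans (UD n i) _.
(* The additive constant is absorbed because the power sum is at least 1. *)
rewrite EFinD ge0_muleDl ?lee_fin// leeD2l// -[leLHS]mule1.
by rewrite lee_wpmul2l ?lee_fin// power_sum_ge1.
Qed.

(* Induction on l: the l.+1-st moment is comparable to the power sum of order l. *)
Lemma power_sum_solidarity H H' l : irreducible P -> H != fset0 -> H' != fset0 ->
  (forall i, i \in H' -> power_sum P l [set j | j \notin H'] i < +oo) ->
  exists2 C : R, (0 <= C)%R & forall i, power_sum P l [set j | j \notin H] i <=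
    C%:E * power_sum P l [set j | j \notin H'] i.
Proof.
move=> irr H0 H'0; set A := [set j | j \notin H]; set A' := [set j | j \notin H'].
elim: l => [|l IH] Sfin.
  apply: power_sum_step => //; exists 1%R => // i.
  by rewrite mul1e !time_moment0.
have [i iH'|C C0 SC] := IH.
  exact: le_lt_trans (power_sum_mono hP l A' i) (Sfin i iH').
apply: power_sum_step => //; exists (l.+1%:R * C)%R => [|i]; first by rewrite mulr_ge0.
apply: le_trans (moment_le_power_sum hP l A i) _.
rewrite EFinM -muleA lee_wpmul2l ?lee_fin//; apply: le_trans (SC i) _.
by rewrite lee_wpmul2l ?lee_fin// power_sum_le_moment.
Qed.

Lemma subsolution_le A l (y : E -> R) (B : R) :
  (forall i, (y i <= B)%R) ->
  (forall i, (y i)%:E <=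
    signed_esum A (fun j => (P i j * y j)%:E) + time_moment P l A i) ->
  forall i, power_sum P l A i < +oo -> (y i)%:E <= power_sum P l A i.
Proof.
move=> yB ydrift i Sfin.
(* A non-negative bound is needed for the positive operator to be applied to it. *)
pose B' := Num.max B 0%R.
have B'0 : (0 <= B')%R by rewrite le_max lexx orbT.
have step n j : (y j)%:E <= power_sum P l A j + B'%:E * avoid P A n j.
  elim: n j => [|n IH] j.
    rewrite mule1 -[leLHS]add0e leeD ?avoid_sum_ge0// lee_fin.
    by rewrite le_max yB.
  apply: le_trans (ydrift j) _.
  rewrite -(power_sumE hP) [leLHS]addeC -addeA leeD2l//.
  rewrite -[avoid P A n.+1 j]/(kernel_on P A (avoid P A n) j).
  rewrite -(kernel_onZ hP)//; last exact: avoid_ge0.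
  rewrite -(kernel_onD hP); first last.
  - by move=> k; rewrite mule_ge0 ?avoid_ge0.
  - by move=> k; exact: avoid_sum_ge0.
  (* Dropping the negative part enlarges the sum, and the positive part of y obeys the same
     non-negative bound. *)
  rewrite /signed_esum -[leRHS]sube0 leeB//; last by apply: esum_ge0.
  apply: le_esum => k _; rewrite /= funeposE ge_max; apply/andP; split.
    by rewrite EFinM lee_wpmul2l.
  by rewrite mule_ge0// adde_ge0 ?avoid_sum_ge0// mule_ge0 ?avoid_ge0.
have Snum : power_sum P l A i \is a fin_num by rewrite ge0_fin_numE ?avoid_sum_ge0.
apply/lee_addgt0Pr => e e0.
pose s := fine (power_sum P l A i).
(* Chosen so that n > B' s / e; since n a^n <= s, the error B' a^n is then at most e. *)
pose n := (Num.truncn (B' * s / e)%R).+1.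
apply: le_trans (step n i) _; rewrite leeD2l//.
have := avoid_le_power_sum hP l n A i.
rewrite -[power_sum _ _ _ _]fineK// -/s -(fineK (avoid_fin hP A n i)).
set a := fine _; rewrite -!EFinM !lee_fin => nas.
have n0 : (0 < n%:R :> R)%R by rewrite ltr0n.
have : (B' * s / e < n%:R)%R by exact: truncnS_gt.
rewrite ltr_pdivrMr// => /ltW Bsn.
rewrite -(ler_pM2l n0); apply: le_trans Bsn.
by rewrite mulrCA ler_wpM2l.
Qed.

End Solidarity.

(** * From the Markov chain to avoidance probabilities *)

Section HittingTimes.
Context {d : measure_display} {Omega : measurableType d} {R : realType}
  {E : countType}.
Variables (P : E -> E -> R) (Pr : E -> probability Omega R)
  (X : nat -> Omega -> E).
Hypotheses (hP : stochastic P) (hX : markov_chain P Pr X).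

Let mX n j : measurable [set w | X n w = j]. Proof. by case: hX. Qed.

Definition cylinder (s : nat -> E) n : set Omega :=
  [set w | forall k, (k <= n)%N -> X k w = s k].

(** The window starts after time [n], leaving X_n free as in [avoid]; for [A] the complement of H,
    [stays A 0 k] is the event sigma_H > k. *)
Definition stays (A : set E) n k : set Omega :=
  [set w | forall m, (n < m <= n + k)%N -> A (X m w)].

Lemma measurable_cylinder s n : measurable (cylinder s n).
Proof.
rewrite (_ : cylinder s n = \bigcap_(k in [set k | (k <= n)%N]) [set w | X k w = s k]).
  by apply: bigcap_measurableType => k _; exact: mX.
by apply/seteqP; split=> w /= h k /= kn; exact: h.
Qed.

Lemma measurable_state A n : measurable [set w | A (X n w)].
Proof.
rewrite (_ : [set _ | _] = \bigcup_j ([set w | X n w = j] `&` [set w | A j])).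
  apply: countable_bigcupT_measurable => [|j]; first exact: countableP.
  apply: measurableI; first exact: mX.
  have [Aj|Aj] := pselect (A j).
    by rewrite (_ : [set _ | _] = setT)//; apply/seteqP; split.
  by rewrite (_ : [set _ | _] = set0)//; apply/seteqP; split.
apply/seteqP; split=> w /=; first by exists (X n w).
by case=> j _ [/= <-].
Qed.

Lemma measurable_stays A n k : measurable (stays A n k).
Proof.
rewrite (_ : stays A n k =
    \bigcap_(m in [set m | (n < m <= n + k)%N]) [set w | A (X m w)]).
  by apply: bigcap_measurableType => m _; exact: measurable_state.
by apply/seteqP; split=> w /= h m /= mn; exact: h.
Qed.

(** The Markov property for avoidance, by induction on [k] with the trajectory varying: the event is
    split by the value of X at time [n.+1]. *)
Lemma cylinder_stays i A k n s :
  Pr i (cylinder s n `&` stays A n k) = Pr i (cylinder s n) * avoid P A k (s n).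
Proof.
elim: k n s => [|k IH] n s.
  rewrite mule1; congr (Pr i _); apply/setIidPl => w _ m.
  by rewrite addn0 => /andP[nm mn]; have := leq_trans nm mn; rewrite ltnn.
(* The trajectory [s] up to time [n], continued by [j]. *)
pose t j m := if (m <= n)%N then s m else j.
have tn j m : (m <= n)%N -> t j m = s m by rewrite /t => ->.
have tS j : t j n.+1 = j by rewrite /t ltnn.
have tE j : A j -> cylinder s n `&` stays A n k.+1 `&` [set w | X n.+1 w = j] =
    cylinder (t j) n.+1 `&` stays A n.+1 k.
  move=> Aj; apply/seteqP; split=> w /= [].
    move=> [sw aw] Xw; split=> m /=.
      by rewrite leq_eqVlt => /orP[/eqP ->|mn]; rewrite ?tS// tn// sw.
    by move=> /andP[nm mk]; apply: aw; rewrite (ltnW nm) -addSnnS.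
  move=> tw aw; have Xj : X n.+1 w = j by rewrite tw// tS.
  split=> //; split=> m /= mn; first by rewrite tw ?tn// leqW.
  case/andP: mn; rewrite leq_eqVlt => /orP[/eqP <- _|nm mk]; first by rewrite Xj.
  by apply: aw; rewrite nm addSnnS.
have tE0 j : ~ A j ->
    cylinder s n `&` stays A n k.+1 `&` [set w | X n.+1 w = j] = set0.
  move=> Aj; apply/seteqP; split=> // w [] /= [_ aw] Xw; apply: Aj.
  by rewrite -Xw; apply: aw; rewrite ltnSn/= addnS ltnS leq_addr.
rewrite (@measure_countable_partition R E _ _ (Pr i) (X n.+1)); last first.
  move=> j; apply: measurableI => //.
  by apply: measurableI; [exact: measurable_cylinder|exact: measurable_stays].
have Pfin : Pr i (cylinder s n) \is a fin_num.
  by apply: fin_num_measure; exact: measurable_cylinder.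
rewrite -(fineK Pfin) -[avoid _ _ _ _]/(kernel_on P A (avoid P A k) (s n)).
rewrite -(kernel_onZ hP) ?fine_ge0//; last exact: avoid_ge0.
rewrite /kernel_on [RHS]esum_mkcond; apply: eq_esum => j _.
case: ifPn => [/set_mem Aj|]; last by rewrite notin_setE => /tE0 ->; rewrite measure0.
rewrite tE//; apply: etrans (IH n.+1 (t j)) _; rewrite tS fineK//.
have -> : Pr i (cylinder (t j) n.+1) = Pr i (cylinder s n) * (P (s n) j)%:E.
  case: hX => _ _ /(_ i n (t j)); rewrite tn// tS => ->; congr (Pr i _ * _).
  by apply/seteqP; split => w /= h m mn; have := h m mn; rewrite tn.
by rewrite muleCA muleA.
Qed.

(** Under [Pr i] the cylinder X_0 = i has probability 1, so intersecting with it loses nothing. *)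
Lemma stays_law i A k : Pr i (stays A 0 k) = avoid P A k i.
Proof.
have mS := measurable_stays A 0 k; have mC := measurable_cylinder (fun=> i) 0.
have CE : cylinder (fun=> i) 0 = [set w | X 0%N w = i].
  apply/seteqP; split=> w /=; first exact.
  by move=> Xw m; rewrite leqn0 => /eqP ->.
have C1 : Pr i (cylinder (fun=> i) 0) = 1 by rewrite CE; case: hX.
have -> : Pr i (stays A 0 k) = Pr i (stays A 0 k `\` cylinder (fun=> i) 0) +
    Pr i (cylinder (fun=> i) 0 `&` stays A 0 k).
  by rewrite [_ `&` stays _ _ _]setIC; exact: measureDI.
rewrite cylinder_stays C1 mul1e.
rewrite (_ : Pr i (_ `\` _) = 0) ?add0e//.
apply/eqP; rewrite eq_le measure_ge0 andbT.
apply: (@le_trans _ _ (Pr i (~` cylinder (fun=> i) 0))).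
  apply: le_measure; rewrite ?inE; [exact: measurableD|exact: measurableC|].
  by move=> w [].
by rewrite probability_setC// C1 subee.
Qed.

Variable H : {fset E}.
Let A : set E := [set j | j \notin H].

(** The indicators select the k < sigma_H, whose weights add up to sigma_H^l. *)
Lemma hitting_time_layers l w : hitting_time X H w ^+ l =
  \sum_(k <oo) (layer_weight l k)%:R%:E * (\1_(stays A 0 k) w)%:E :> \bar R.
Proof.
have f0 k : 0 <= (layer_weight l k)%:R%:E * (\1_(stays A 0 k) w)%:E :> \bar R.
  by rewrite mule_ge0 ?lee_fin// indicE.
have [hit|nhit] := pselect (exists n, (0 < n)%N && (X n w \in H)).
  case: (ex_minnP hit) => m /andP[m0 mH] mmin.
  have -> : hitting_time X H w = m%:R%:E :> \bar R.
    apply/eqP; rewrite eq_le; apply/andP; split.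
      by apply: ereal_inf_lbound; exists m.
    apply: le_ereal_inf_tmp => _ [n [n0 nH] <-].
    by rewrite lee_fin ler_nat mmin// n0.
  rewrite (nneseries_split _ m)// add0n eseries0 ?adde0; last first.
    move=> k mk _; rewrite indicE memNset ?mule0// => /(_ m).
    by rewrite /A/= m0 add0n mk mH => /(_ isT).
  have -> : \sum_(0 <= k < m) (layer_weight l k)%:R%:E * (\1_(stays A 0 k) w)%:E =
      \sum_(0 <= k < m) (layer_weight l k)%:R%:E :> \bar R.
    apply: eq_big_nat => k km; rewrite indicE mem_set ?mule1// => n /andP[n0 nk].
    apply/negP => nH; have := mmin n; rewrite n0 nH => /(_ isT).
    by rewrite leqNgt (leq_ltn_trans nk).
  rewrite sumEFin -natr_sum big_mkord -(prednK m0) layer_weight_sum.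
  by rewrite -EFin_expe natrX.
have -> : hitting_time X H w = +oo :> \bar R.
  rewrite /hitting_time (_ : [set _ | _ in _] = set0) ?ereal_inf0//.
  by apply/seteqP; split=> // x [n [n0 nH] _]; apply: nhit; exists n; rewrite n0.
have -> : \sum_(k <oo) (layer_weight l k)%:R%:E * (\1_(stays A 0 k) w)%:E =
    \sum_(k <oo) (layer_weight l k)%:R%:E :> \bar R.
  apply: eq_eseriesr => k _; rewrite indicE mem_set ?mule1// => n /andP[n0 nk].
  by apply/negP => nH; apply: nhit; exists n; rewrite n0.
(* Without a hit all weights are summed: for [l = 0] only the weight of 0 is nonzero, matching the
   convention for the power 0; otherwise the sum diverges. *)
case: l {f0} => [|l].
  by rewrite nneseries_recS// eseries0 ?adde0.
have -> : +oo ^+ l.+1 = +oo :> \bar R.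
  by elim: l => // l IH; rewrite expeS IH mulyy.
apply/esym/eqyP => x x0.
apply: le_trans (nneseries_lim_ge (Num.truncn x).+1 _) => //.
rewrite sumEFin lee_fin -natr_sum big_mkord layer_weight_sum.
apply: (@le_trans _ _ (Num.truncn x).+1%:R); first exact/ltW/truncnS_gt.
by rewrite ler_nat expnS leq_pmulr// expn_gt0.
Qed.

Lemma hitting_momentE l i : hitting_moment Pr X H l i = time_moment P l A i.
Proof.
rewrite /hitting_moment; under eq_integral do rewrite hitting_time_layers.
rewrite integral_nneseries//; last first.
  move=> k; apply: measurable_funeM; apply/measurable_EFinP.
  by apply: measurable_indic; exact: measurable_stays.
apply: eq_eseriesr => k _; rewrite ge0_integralZl_EFin//; last first.
  by apply/measurable_EFinP; apply: measurable_indic; exact: measurable_stays.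
rewrite integral_indic//; last exact: measurable_stays.
by rewrite setIT; congr (_ * _); exact: stays_law.
Qed.

End HittingTimes.

(** * Finite maxima and upper limits *)

Section Suprema.
Context {R : realType}.

Lemma le_bigmaxe (T : eqType) (s : seq T) (f : T -> \bar R) x : x \in s ->
  f x <= \big[maxe/-oo]_(i <- s) f i.
Proof.
elim: s => // y s IH; rewrite inE big_cons le_max.
by case/orP => [/eqP -> | /IH ->]; rewrite ?lexx ?orbT.
Qed.

Lemma bigmaxe_lty (T : eqType) (s : seq T) (f : T -> \bar R) :
  (forall x, x \in s -> f x < +oo) -> \big[maxe/-oo]_(i <- s) f i < +oo.
Proof.
by move=> fs; rewrite big_seq; exact: bigmax_lt.
Qed.

(** With every term below +oo, removing finitely many terms cannot make an infinite supremum
    finite. *)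
Lemma limn_esup_pinfty (u : nat -> \bar R) : (forall n, u n < +oo) ->
  ereal_sup [set u n | n in [set n : nat | (1 <= n)%N]] = +oo <->
  limn_esup u = +oo.
Proof.
move=> ufin.
have -> : limn_esup u = ereal_inf (range (esups u)).
  by rewrite limn_esup_lim; apply/cvg_lim => //; exact: cvg_esups_inf.
split=> [supu|infu]; last first.
  apply/eqP; rewrite -leye_eq -infu; apply: ereal_inf_lbound.
  by exists 1%N.
apply/eqP; rewrite -leye_eq; apply: le_ereal_inf_tmp => _ [n _ <-].
rewrite leNgt; apply/negP => esupn.
have : \big[maxe/-oo]_(k <- iota 0 n) u k < +oo by exact: bigmaxe_lty.
move=> maxn; suff : ereal_sup [set u n | n in [set n : nat | (1 <= n)%N]] < +oo.
  by rewrite supu ltxx.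
apply: (@le_lt_trans _ _ (maxe (esups u n) (\big[maxe/-oo]_(k <- iota 0 n) u k))).
  apply: ge_ereal_sup => _ [k _ <-]; rewrite le_max.
  have [nk|kn] := leqP n k; last by rewrite le_bigmaxe ?orbT// mem_iota.
  by apply/orP; left; apply: ereal_sup_ubound; exists k.
by rewrite gt_max esupn.
Qed.

End Suprema.

(** * Both directions of the criterion, and the upper-limit form of its second condition *)

Theorem mainTheorem7 (d : measure_display) (Omega : measurableType d)
    (R : realType) (E : countType) (P : E -> E -> R)
    (Pr : E -> probability Omega R) (X : nat -> Omega -> E)
    (hP : stochastic P) (hirr : irreducible P) (haper : aperiodic P)
    (hX : markov_chain P Pr X)
    (H : {fset E}) (hH : H != fset0)
    (l : nat) (hl : l_ergodic Pr X l) :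
  (~ l_ergodic Pr X l.+1 <->
   exists y : nat -> E -> R,
     (forall n : nat, (1 <= n)%N ->
        ereal_sup (range (fun i => (y n i)%:E)) < +oo /\
        drift_inequality P Pr X H l (y n)) /\
     ereal_sup [set \big[maxe/-oo]_(i <- H) (y n i)%:E
               | n in [set n : nat | (1 <= n)%N]] = +oo)
  /\
  (forall y : nat -> E -> R,
     ereal_sup [set \big[maxe/-oo]_(i <- H) (y n i)%:E
               | n in [set n : nat | (1 <= n)%N]] = +oo <->
     limn_esup (fun n => \big[maxe/-oo]_(i <- H) (y n i)%:E) = +oo).
Proof.
split; last first.
  by move=> y; apply: limn_esup_pinfty => n; apply: bigmaxe_lty => i _; exact: ltry.
pose A := [set j : E | j \notin H].
split=> [nerg|[y [ydrift ysup]] [H' H'0 erg]].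
  (* If S were finite on [H], the moments of order [l.+1] would be finite there and [H] would
     witness ergodicity. *)
  have [i iH Soo] : exists2 i, i \in H & power_sum P l A i = +oo.
    apply: contra_notP nerg => nS; exists H => //; apply: bigmaxe_lty => i iH.
    rewrite (hitting_momentE hP hX); apply: le_lt_trans (moment_le_power_sum hP l A i) _.
    rewrite -ge0_fin_numE ?mule_ge0 ?avoid_sum_ge0// fin_numM//.
    rewrite ge0_fin_numE ?avoid_sum_ge0// lt_neqAle leey andbT.
    by apply/eqP => Soo; apply: nS; exists i.
  have psumE n j : (fine (power_psum P l n A j))%:E = power_psum P l n A j.
    by rewrite fineK// power_psum_fin.
  exists (fun n j => fine (power_psum P l n A j)); split=> [n _|].
    split=> [|j].
      apply: le_lt_trans (ltry (\sum_(k < n) (k.+1 ^ l)%:R)%R).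
      apply: ge_ereal_sup => _ [j _ <-]; rewrite psumE.
      exact: power_psum_bound.
    rewrite psumE (hitting_momentE hP hX).
    apply: le_trans (power_psumS hP l n A j) _.
    apply: le_trans (power_psum_drift hP l n A j) _.
    rewrite addeC leeD2r// /signed_esum.
    have term0 k : 0 <= (P j k * fine (power_psum P l n A k))%:E.
      by rewrite lee_fin mulr_ge0 ?fine_ge0 ?power_psum_ge0//; case: hP.
    (* The partial sums are non-negative, so the signed sum is an ordinary one. *)
    rewrite [X in _ - X]esum1 ?sube0; last first.
      by move=> k _; rewrite /= funenegE max_r// oppe_le0.
    apply: le_esum => k _; rewrite /= funeposE max_l//.
    by rewrite EFinM psumE.
  apply/eqP; rewrite -leye_eq -Soo; apply: power_sum_le => // n.
  (* Passing to [n.+1] keeps the index in the range n >= 1 of the supremum. *)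
  apply: le_trans (power_psumS hP l n A i) _.
  apply: (@le_trans _ _ (\big[maxe/-oo]_(i <- H) (fine (power_psum P l n.+1 A i))%:E)).
    by rewrite -psumE (le_bigmaxe (fun i => (fine (power_psum P l n.+1 A i))%:E)).
  by apply: ereal_sup_ubound; exists n.+1.
(* Ergodicity comes with its own finite set [H'], possibly different from [H]; solidarity transfers
   finiteness to [H]. *)
have S'fin i : i \in H' -> power_sum P l [set j | j \notin H'] i < +oo.
  move=> iH'; apply: le_lt_trans (power_sum_le_moment hP l _ i) _.
  rewrite -(hitting_momentE hP hX); apply: le_lt_trans erg.
  exact: (le_bigmaxe (hitting_moment Pr X H' l.+1)).
have [C C0 SC] := power_sum_solidarity hP hirr hH H'0 S'fin.
have Sfin i : power_sum P l A i < +oo.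
  apply: le_lt_trans (SC i) _.
  rewrite -ge0_fin_numE ?mule_ge0 ?avoid_sum_ge0// fin_numM//.
  by rewrite ge0_fin_numE ?avoid_sum_ge0// power_sum_finite.
(* The maximum of S over the finite set [H] is a finite bound for all y^(n) on [H]. *)
have : \big[maxe/-oo]_(i <- H) power_sum P l A i < +oo by apply: bigmaxe_lty.
rewrite -ysup ltNge => /negP; apply.
apply: ge_ereal_sup => _ [n n1 <-].
have [ybnd ydr] := ydrift n n1.
pose B := fine (ereal_sup (range (fun i => (y n i)%:E))).
have yB i : (y n i <= B)%R.
  have yi : (y n i)%:E <= ereal_sup (range (fun i => (y n i)%:E)).
    by apply: ereal_sup_ubound; exists i.
  rewrite -lee_fin fineK// fin_numE -ltey ybnd andbT -ltNye.
  by apply: lt_le_trans yi; exact: ltNyr.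
have yS i : (y n i)%:E <= power_sum P l A i.
  apply: (subsolution_le hP yB _ (Sfin i)) => j.
  by rewrite -(hitting_momentE hP hX).
rewrite big_seq; apply: bigmax_le => [|i iH]; first exact: leNye.
exact: le_trans (yS i) (le_bigmaxe _ iH).
Qed.
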